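(* Let $A\in\mathbb{R}^{n\times n}$ be stable, let $V=\{b_1,\dots,b_M\}$ be a finite set of column vectors in $\mathbb{R}^n$, not all zero, and for $S\subseteq V$ let $W_S=\int_0^\infty e^{A\tau}\big(\sum_{b\in S} b b^T\big)e^{A^T\tau}\,d\tau$ be the infinite-horizon controllability Gramian. Then the set function $f:2^V\to\mathbb{R}$, $f(S)=\lambda_n(W_S)$ (the minimum eigenvalue of $W_S$), is nonnegative, monotone nondecreasing and normalized. Moreover, the submodularity ratio $\gamma$ and the curvature $\alpha$ of $f$ are bounded by $$\gamma \ \geq\ \frac{\min_{\omega\in V}\lambda_n(W_\omega)}{\max_{\omega\in V}\lambda_1(W_\omega)},\qquad \alpha\ \leq\ 1-\frac{\min_{\omega\in V}\lambda_n(W_\omega)}{\max_{\omega\in V}\lambda_1(W_\omega)}.$$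
   Context: A real square matrix $A$ is stable if all its eigenvalues have strictly negative real part. For a real symmetric $n\times n$ matrix $M$, $\lambda_1(M)\geq\lambda_2(M)\geq\dots\geq\lambda_n(M)$ denote its eigenvalues. The set $V$ is the set of possible actuator locations (columns of the input matrix); elements of $V$ are indexed by $1,\dots,M$. A single element $\omega\in V$ is identified with the singleton $\{\omega\}$, so $W_\omega=W_{\{\omega\}}$; $W_\emptyset=0$. Let $f:2^V\to\mathbb{R}$ be a set function. It is monotone nondecreasing if $f(A\cup\{s\})\geq f(A)$ for all $A\subseteq V$, $s\in V$, and normalized if $f(\emptyset)=0$. For $A,B\subseteq V$ write $\rho_A(B):=f(A\cup B)-f(B)$ for the marginal benefit of $A$ with respect to $B$. The submodularity ratio of $f$ is the largest $\gamma\in\mathbb{R}_+$ (nonnegative reals) such that $\sum_{\omega\in\Omega\setminus S}\rho_\omega(S)\geq\gamma\,\rho_\Omega(S)$ for all $\Omega,S\subseteq V$. The curvature of $f$ is the smallest $\alpha\in\mathbb{R}_+$ such that $\rho_j\big((S\setminus\{j\})\cup\Omega\big)\geq(1-\alpha)\,\rho_j(S\setminus\{j\})$ for all $\Omega,S\subseteq V$ and all $j\in S\setminus\Omega$. *)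

(* Defs.v *)
From mathcomp Require Import all_boot all_order all_algebra.
From mathcomp Require Import polyrcf complex.
From mathcomp Require Import all_classical all_reals all_analysis.

Set Implicit Arguments.
Unset Strict Implicit.
Unset Printing Implicit Defensive.

Import Order.TTheory GRing.Theory Num.Theory.
Import numFieldNormedType.Exports.

Local Open Scope ring_scope.

Section Matrices.
Variables (R : realType) (n : nat).
Implicit Types A M : 'M[R]_n.

(* The spectrum is taken over the complex numbers R[i]. *)
Definition stable A : Prop :=
  forall z : R[i], eigenvalue (map_mx (real_complex R) A) z ->
    complex.Re z < 0.

Definition expmx A : 'M[R]_n :=
  limn (series (fun k : nat => (k`!%:R)^-1 *: A ^+ k)).

(* Real eigenvalues with algebraic multiplicity, in nonincreasing order; for a
   symmetric matrix this is its whole spectrum, a list of length n. *)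
Definition eigvals M : seq R :=
  sort >=%R (flatten [seq nseq (mup x (char_poly M)) x
                     | x <- rootsR (char_poly M)]).

(* Numbered from 1: lambda 1 M is the largest eigenvalue of a symmetric M and
   lambda n M the smallest one. *)
Definition lambda (k : nat) M : R := nth 0 (eigvals M) k.-1.

Definition gramian m A (b : 'I_m -> 'cV[R]_n) (S : {set 'I_m}) : 'M[R]_n :=
  \matrix_(i, j)
    \int[lebesgue_measure]_(t in `[0, +oo[%classic)
      (expmx (t *: A) *m (\sum_(k in S) b k *m (b k)^T) *m expmx (t *: A^T)) i j.

End Matrices.

(* Extrema of a real function over a finite type (0 if the type is empty). *)
Definition fmin (R : realType) (T : finType) (F : T -> R) : R :=
  if [pick x : T] is Some x0 then \big[Num.min/F x0]_(x : T) F x else 0.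

Definition fmax (R : realType) (T : finType) (F : T -> R) : R :=
  if [pick x : T] is Some x0 then \big[Num.max/F x0]_(x : T) F x else 0.

Section SetFunctions.
Variables (R : realType) (V : finType).
Implicit Types (f : {set V} -> R) (g a : R).

Definition set_nonneg f : Prop := forall A, 0 <= f A.

Definition set_monotone f : Prop :=
  forall (A : {set V}) (s : V), f A <= f (A :|: [set s]%SET).

Definition set_normalized f : Prop := f finset.set0 = 0.

Definition marginal f (A B : {set V}) : R := f (A :|: B) - f B.

Definition submod_admissible f g : Prop :=
  0 <= g /\ forall Omega S : {set V},
    g * marginal f Omega S <=
      \sum_(w in Omega :\: S) marginal f [set w]%SET S.

Definition curv_admissible f a : Prop :=
  0 <= a /\ forall (Omega S : {set V}) (j : V), j \in S :\: Omega ->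
    (1 - a) * marginal f [set j]%SET (S :\ j) <=
      marginal f [set j]%SET ((S :\ j) :|: Omega).

(* Extended-real valued: when f is constant every g >= 0 is admissible, there is
   no largest one, and the ratio is +oo.  A finite ratio is the largest
   admissible value, see submodularity_ratioP. *)
Definition submodularity_ratio f : \bar R :=
  ereal_sup (EFin @` [set g | submod_admissible f g])%classic.

(* A finite curvature is the smallest admissible value, see curvatureP. *)
Definition curvature f : \bar R :=
  ereal_inf (EFin @` [set a | curv_admissible f a])%classic.

Lemma le_approx (x y c d : R) :
  (forall e, 0 < e -> exists2 z, `|z - x| < e & z * c <= d) -> x * c <= d.
Proof.
move=> H; rewrite leNgt; apply/negP => dc.
have e0 : 0 < (x * c - d) / (`|c| + 1).
  by rewrite divr_gt0 ?subr_gt0// ltr_wpDl.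
have [z zx zc] := H _ e0.
have c1 : 0 < `|c| + 1 by rewrite ltr_wpDl.
move: zx; rewrite ltr_pdivlMr// => zx.
have : x * c - z * c <= `|z - x| * (`|c| + 1).
  rewrite -mulrBl distrC (le_trans (ler_norm _))// normrM.
  by rewrite ler_wpM2l// lerDl.
move=> /le_lt_trans /(_ zx); rewrite ltrD2l ltrN2 => h.
by have := lt_le_trans h zc; rewrite ltxx.
Qed.

Lemma submodularity_ratioP f g :
  submodularity_ratio f = g%:E <->
  submod_admissible f g /\ forall h, submod_admissible f h -> h <= g.
Proof.
split=> [fg|[fg gmax]]; last first.
  apply/eqP; rewrite eq_le; apply/andP; split.
    by apply: ge_ereal_sup => _ [h /= /gmax hg <-]; rewrite lee_fin.
  by apply: ereal_sup_ubound; exists g.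
have ub h : submod_admissible f h -> h <= g.
  by move=> fh; rewrite -lee_fin -fg; apply: ereal_sup_ubound; exists h.
have approx e : 0 < e -> exists2 z, `|z - g| < e & submod_admissible f z.
  move=> e0; have : (g%:E - e%:E < submodularity_ratio f)%E.
    by rewrite fg -EFinB lte_fin ltrBlDr ltrDl.
  move=> /ereal_sup_gt[_ [z fz <-]]; rewrite -EFinB lte_fin => gz.
  by exists z => //; rewrite ler0_norm ?subr_le0 ?ub// opprB ltrBlDr -ltrBlDl.
split=> //; split.
  have [z _ fz] := approx 1 ltr01.
  by apply: le_trans (ub z fz); case: fz.
move=> Omega S; apply: le_approx => // e /approx[z ze [_ fz]].
by exists z.
Qed.

Lemma curvatureP f a :
  curvature f = a%:E <->
  curv_admissible f a /\ forall h, curv_admissible f h -> a <= h.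
Proof.
split=> [fa|[fa amin]]; last first.
  apply/eqP; rewrite eq_le; apply/andP; split.
    by apply: ereal_inf_lbound; exists a.
  by apply: le_ereal_inf_tmp => _ [h /= /amin ah <-]; rewrite lee_fin.
have lb h : curv_admissible f h -> a <= h.
  by move=> fh; rewrite -lee_fin -fa; apply: ereal_inf_lbound; exists h.
have approx e : 0 < e -> exists2 z, `|z - a| < e & curv_admissible f z.
  move=> e0; have : (curvature f < a%:E + e%:E)%E.
    by rewrite fa -EFinD lte_fin ltrDl.
  move=> /ereal_inf_lt[_ [z fz <-]]; rewrite -EFinD lte_fin => az.
  by exists z => //; rewrite ger0_norm ?subr_ge0 ?lb// ltrBlDl.
split=> //; split.
  have a_ge e : 0 < e -> 0 <= a + e.
    move=> /approx[z ze [z0 fz]]; have az : a <= z by apply: lb; split.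
    by move: ze; rewrite ger0_norm ?subr_ge0// ltrBlDl => /ltW; apply: le_trans.
  by apply/ler_addgt0Pr.
move=> Omega S j jS; apply: le_approx => // e /approx[z ze [_ fz]].
by exists (1 - z); [rewrite opprB addrC addrA subrK distrC | exact: fz].
Qed.

End SetFunctions.

(* Main.v *)
Require Import Defs.
From mathcomp Require Import all_boot all_order all_algebra.
From mathcomp Require Import polyrcf complex ring lra.
From mathcomp Require Import all_classical all_reals all_analysis.
From mathcomp Require Import measurable_realfun.

(* The Gramian is additive over disjoint unions, so W_(S u T) = W_S + W_T with
   symmetric positive semidefinite summands, and Weyl's inequalities
     lambda_n M + lambda_n N <= lambda_n (M + N) <= lambda_n M + lambda_1 N
   bound every marginal of f from below by the least lambda_n (W_w) and from
   above by |Omega \ S| times the greatest lambda_1 (W_w).  Additivity needs the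
   Gramian integral to converge.  With z_1, ..., z_n the complex eigenvalues of
   A, the matrices Y_k = (A - z_1) ... (A - z_k) e^(tA) satisfy
   Y_k' = z_(k+1) Y_k + Y_(k+1), and Y_n = 0 by Cayley-Hamilton; since
   Re z_k < 0, exponential decay propagates from Y_n down to Y_0 = e^(tA). *)

Set Implicit Arguments.
Unset Strict Implicit.
Unset Printing Implicit Defensive.

Import Order.TTheory GRing.Theory Num.Theory.
Import numFieldNormedType.Exports.

Local Open Scope ring_scope.

(** * Quadratic forms and the spectral theorem for real symmetric matrices *)

Definition qform (R : pzRingType) n (M : 'M[R]_n) (u : 'rV[R]_n) : R :=
  (u *m M *m u^T) 0 0.

(** Counts are compared value by value: in [eigvals M] the count of [x] is its multiplicity as a
    root, and in a split polynomial that multiplicity is the count of [x] among the linear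
    factors. *)
Lemma perm_eigvals (R : realType) n (M : 'M[R]_n) (s : seq R) :
  char_poly M = \prod_(x <- s) ('X - x%:P) -> perm_eq (eigvals M) s.
Proof.
move=> Ms; have M0 : char_poly M != 0 by rewrite monic_neq0 ?char_poly_monic.
rewrite /eigvals perm_sort; apply/allP => x _ /=; apply/eqP.
rewrite count_flatten -map_comp.
under eq_map => y do rewrite /= count_nseq /=.
rewrite sumnE big_map -mu_prod_XsubC -Ms.
have uR : uniq (rootsR (char_poly M)) by exact: uniq_roots.
have [Mx|Mx] := boolP (x \in rootsR (char_poly M)).
  rewrite (bigD1_seq x)//= eqxx mul1n big1 ?addn0// => y /negPf.
  by move=> ->; rewrite mul0n.
rewrite big1_seq => [|y /= yM].
  rewrite mupNroot//; by have := roots_on_rootsR M0 x; rewrite /= => ->.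
by case: eqP => // yx; rewrite -yx yM in Mx.
Qed.

Lemma char_poly_conj (F : fieldType) n (P D : 'M[F]_n) :
  P \in unitmx -> char_poly (invmx P *m D *m P) = char_poly D.
Proof.
move=> Pu; rewrite /char_poly.
have -> : char_poly_mx (invmx P *m D *m P) =
    map_mx polyC (invmx P) *m char_poly_mx D *m map_mx polyC P.
  rewrite /char_poly_mx mulmxBr mulmxBl -!map_mxM/=; congr (_ - _).
  by rewrite scalar_mxC -mulmxA -map_mxM mulVmx// map_mx1 mulmx1.
by rewrite !det_mulmx mulrAC -det_mulmx -map_mxM mulVmx// map_mx1 det1 mul1r.
Qed.

(** Obtained from the unitary diagonalization over [R[i]], whose diagonal is real. Only real data
    are kept: both forms share the weights [w], so bounds on them reduce to termwise bounds on the
    eigenvalues [d]. *)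
Lemma symmetric_spectral (R : realType) n (M : 'M[R]_n) : M^T = M ->
  exists2 d : 'I_n -> R, perm_eq (eigvals M) [seq d i | i <- enum 'I_n] &
    forall u : 'rV[R]_n, exists w : 'I_n -> R,
      [/\ forall i, 0 <= w i, qform 1%:M u = \sum_i w i
        & qform M u = \sum_i d i * w i].
Proof.
move=> Msym; pose C := real_complex R; pose MC := map_mx C M.
have CR x : C x \is Num.real by apply/complex_realP; exists x.
have MCreal : MC \is a mxOver Num.real.
  by apply/mxOverP => i j; rewrite mxE.
have MCsym : MC \is symmetricmx.
  apply/is_hermitianmxP; rewrite expr0 scale1r.
  by apply/matrixP => i j; rewrite !mxE -[in LHS]Msym mxE.
have MCherm := realsym_hermsym MCsym MCreal.
have /orthomx_spectralP := hermitian_normalmx MCherm.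
set P := spectralmx MC; set D := spectral_diag MC => MCE.
have Pu : P \is unitarymx := spectral_unitarymx MC.
have Dreal : D \is a mxOver Num.real := hermitian_spectral_diag_real MCherm.
pose d i := complex.Re (D 0 i).
have Dd i : D 0 i = C (d i) by rewrite /C /d/= RRe_real// (mxOverP Dreal).
exists d => [|u].
  apply: perm_eigvals; apply: (@map_poly_inj _ _ C).
  rewrite map_char_poly -/MC rmorph_prod/=.
  rewrite big_map big_enum/=.
  rewrite MCE.
  have -> : char_poly (invmx P *m diag_mx D *m P) = char_poly (diag_mx D).
    exact/char_poly_conj/unitarymx_unit.
  rewrite char_poly_trig ?diag_mx_is_trig//.
  apply: eq_bigr => i _; rewrite mxE eqxx mulr1n Dd.
  by rewrite rmorphB/= map_polyX map_polyC.
(* The coordinates of [u] in the orthonormal eigenbasis formed by the rows of [P]; their squared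
   moduli will be the weights. *)
pose v := map_mx C u *m invmx P.
have conjC0 (z : R) : (C z)^* = C z by apply/CrealP.
have qE (E : 'M[R[i]]_n) :
    map_mx C u *m (invmx P *m E *m P) *m (map_mx C u)^T =
      v *m E *m map_mx Num.conj v^T.
  have <- : P *m (map_mx C u)^T = map_mx Num.conj v^T.
    rewrite /v invmx_unitary// trmx_mul map_mxM/= trmxCK; congr (_ *m _).
    by apply/matrixP=> i j; rewrite !mxE conjC0.
  by rewrite /v !mulmxA.
exists (fun i => complex.Re (`|v 0 i| ^+ 2)).
have wE i : C (complex.Re (`|v 0 i| ^+ 2)) = `|v 0 i| ^+ 2.
  by rewrite /C RRe_real// realX.
split.
- by move=> i; have := exprn_ge0 2 (normr_ge0 (v 0 i)); rewrite -wE ler0c.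
- apply: complexI.
  transitivity (\sum_i v 0 i * (v 0 i)^*); last first.
    by rewrite rmorph_sum; apply: eq_bigr => i _; rewrite -normCK -wE.
  rewrite [LHS](_ : _ = (map_mx C u *m 1%:M *m (map_mx C u)^T) 0 0); last first.
    by rewrite /qform !mulmx1 map_trmx -map_mxM [RHS]mxE.
  rewrite -[1%:M in LHS](mulVmx (unitarymx_unit Pu)) -[invmx P in LHS]mulmx1.
  rewrite qE mulmx1 !mxE.
  by apply: eq_bigr => i _; rewrite !mxE.
- apply: complexI.
  transitivity (\sum_i D 0 i * (v 0 i * (v 0 i)^*)); last first.
    rewrite rmorph_sum; apply: eq_bigr => i _.
    by rewrite rmorphM -normCK -wE Dd.
  rewrite [LHS](_ : _ = (map_mx C u *m MC *m (map_mx C u)^T) 0 0); last first.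
    by rewrite /qform map_trmx -!map_mxM [RHS]mxE.
  rewrite MCE qE !mxE.
  by apply: eq_bigr => i _; rewrite mul_mx_diag !mxE mulrCA mulrA.
Qed.

Lemma size_eigvals (R : realType) n (M : 'M[R]_n) :
  M^T = M -> size (eigvals M) = n.
Proof.
move=> /symmetric_spectral[d /perm_size -> _].
by rewrite size_map size_enum_ord.
Qed.

Lemma sorted_eigvals (R : realType) n (M : 'M[R]_n) :
  sorted >=%R (eigvals M).
Proof. by apply: sort_sorted => x y; exact: le_total. Qed.

(** * Extreme eigenvalues as extrema of the Rayleigh quotient *)

Section Rayleigh.
Variables (R : realType) (n : nat) (M : 'M[R]_n.+1).
Hypothesis Msym : M^T = M.

Lemma lambda_min_le x : x \in eigvals M -> lambda n.+1 M <= x.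
Proof.
move=> xM; rewrite /lambda/= -(nth_index 0 xM).
have := sorted_eigvals M; rewrite -index_mem size_eigvals// in xM.
move=> /(sorted_leq_nth ge_trans (@lexx _ R) 0).
move=> /(_ (index x (eigvals M)) n); rewrite !inE size_eigvals//; exact.
Qed.

Lemma lambda_max_ge x : x \in eigvals M -> x <= lambda 1 M.
Proof.
move=> xM; rewrite /lambda/= -{1}(nth_index 0 xM).
have := sorted_eigvals M; rewrite -index_mem size_eigvals// in xM.
move=> /(sorted_leq_nth ge_trans (@lexx _ R) 0).
move=> /(_ 0 (index x (eigvals M))); rewrite !inE size_eigvals//; exact.
Qed.

Lemma lambda_min_qform u : lambda n.+1 M * qform 1%:M u <= qform M u.
Proof.
have [d dM /(_ u)[w [w0 -> ->]]] := symmetric_spectral Msym.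
rewrite mulr_sumr; apply: ler_sum => i _; apply: ler_wpM2r => //.
by apply: lambda_min_le; rewrite (perm_mem dM) map_f// mem_enum.
Qed.

Lemma lambda_max_qform u : qform M u <= lambda 1 M * qform 1%:M u.
Proof.
have [d dM /(_ u)[w [w0 -> ->]]] := symmetric_spectral Msym.
rewrite mulr_sumr; apply: ler_sum => i _; apply: ler_wpM2r => //.
by apply: lambda_max_ge; rewrite (perm_mem dM) map_f// mem_enum.
Qed.

Lemma qform1_gt0 (u : 'rV[R]_n.+1) : u != 0 -> 0 < qform 1%:M u.
Proof.
move=> /rV0Pn[i ui]; rewrite /qform mulmx1 mxE (bigD1 i)//=.
apply: ltr_wpDr; first by apply: sumr_ge0 => j _; rewrite mxE -expr2 sqr_ge0.
by rewrite mxE -expr2 exprn_even_gt0.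
Qed.

Lemma eigvals_qform x : x \in eigvals M ->
  exists2 u : 'rV_n.+1, u != 0 & qform M u = x * qform 1%:M u.
Proof.
move=> xM; have : eigenvalue M x.
  have M0 : char_poly M != 0 by rewrite monic_neq0 ?char_poly_monic.
  rewrite eigenvalue_root_char.
  move: xM; rewrite mem_sort => /flatten_mapP[y].
  by rewrite -(roots_on_rootsR M0) => yM /nseqP[-> _].
case/eigenvalueP => u uM u0; exists u => //.
by rewrite /qform uM mulmx1 -scalemxAl mxE.
Qed.

Lemma lambda_min_attained :
  exists2 u : 'rV_n.+1, u != 0 & qform M u = lambda n.+1 M * qform 1%:M u.
Proof. by apply: eigvals_qform; rewrite mem_nth// size_eigvals. Qed.

Lemma lambda_max_attained :
  exists2 u : 'rV_n.+1, u != 0 & qform M u = lambda 1 M * qform 1%:M u.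
Proof. by apply: eigvals_qform; rewrite mem_nth// size_eigvals. Qed.

End Rayleigh.

Lemma qformD (R : pzRingType) n (M N : 'M[R]_n) u :
  qform (M + N) u = qform M u + qform N u.
Proof. by rewrite /qform mulmxDr mulmxDl mxE. Qed.

(** * Weyl's inequalities *)

Section Weyl.
Variables (R : realType) (n : nat) (M N : 'M[R]_n.+1).
Hypotheses (Msym : M^T = M) (Nsym : N^T = N).

Let MNsym : (M + N)^T = M + N.
Proof. by rewrite linearD/= Msym Nsym. Qed.

(** At a minimizing eigenvector of [M + N] both forms are bounded below by their own least
    eigenvalues. *)
Lemma lambda_minD_ge :
  lambda n.+1 M + lambda n.+1 N <= lambda n.+1 (M + N).
Proof.
have [u u0 uMN] := lambda_min_attained MNsym.
rewrite -(ler_pM2r (qform1_gt0 u0)) -uMN qformD mulrDl.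
by apply: lerD; exact: lambda_min_qform.
Qed.

(** The test vector is a minimizing eigenvector of [M] alone: it makes the [M] term exact, and the
    [N] term is at most [lambda 1 N]. *)
Lemma lambda_minD_le :
  lambda n.+1 (M + N) <= lambda n.+1 M + lambda 1 N.
Proof.
have [u u0 uM] := lambda_min_attained Msym.
rewrite -(ler_pM2r (qform1_gt0 u0)) mulrDl -uM.
apply: le_trans (lambda_min_qform MNsym u) _.
by rewrite qformD lerD2l; exact: lambda_max_qform.
Qed.

Lemma lambda_maxD_le :
  lambda 1 (M + N) <= lambda 1 M + lambda 1 N.
Proof.
have [u u0 uMN] := lambda_max_attained MNsym.
rewrite -(ler_pM2r (qform1_gt0 u0)) -uMN qformD mulrDl.
by apply: lerD; exact: lambda_max_qform.
Qed.

Lemma lambda_min_le_max : lambda n.+1 M <= lambda 1 M.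
Proof. by apply: lambda_max_ge => //; rewrite mem_nth// size_eigvals. Qed.

End Weyl.

Lemma lambda_min_ge0 (R : realType) n (M : 'M[R]_n.+1) : M^T = M ->
  (forall u, 0 <= qform M u) -> 0 <= lambda n.+1 M.
Proof.
move=> Msym M0; have [u u0 uM] := lambda_min_attained Msym.
by rewrite -(pmulr_lge0 _ (qform1_gt0 u0)) -uM.
Qed.

Lemma lambda0 (R : realType) n k : lambda k (0 : 'M[R]_n) = 0.
Proof.
rewrite /lambda.
(* Past the end of the list [nth] returns its default 0, so every index [k] is covered, and
   dimension 0 as well. *)
have [kn|] := ltnP k.-1 (size (eigvals (0 : 'M[R]_n))); last first.
  exact: nth_default.
case: n kn => [|n] kn; first by move: kn; rewrite size_eigvals// trmx0.
have [] := @eigvals_qform R n 0 _ (mem_nth 0 kn).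
move=> u u0; rewrite {1}/qform mulmx0 mul0mx mxE => /esym/eqP.
by rewrite mulf_eq0 (gt_eqF (qform1_gt0 u0)) orbF => /eqP.
Qed.

(** * The quotient of extrema that appears in the bounds *)

Section Extrema.
Variables (R : realType) (T : finType).
Implicit Types F lo hi : T -> R.

Lemma fmin_le F w : fmin F <= F w.
Proof.
rewrite /fmin; case: pickP => [x0 _|/(_ w)//].
exact: bigmin_le_cond.
Qed.

Lemma fmax_ge F w : F w <= fmax F.
Proof.
rewrite /fmax; case: pickP => [x0 _|/(_ w)//].
exact: le_bigmax_cond.
Qed.

Lemma fmin_ge0 F : (forall w, 0 <= F w) -> 0 <= fmin F.
Proof.
move=> F0; rewrite /fmin; case: pickP => // x0 _.
by apply: le_bigmin => //.
Qed.

(* If fmax hi = 0 the quotient is 0, and the bounds hold trivially. *)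
Lemma fmin_fmax_ratio lo hi :
  (forall w, 0 <= lo w) -> (forall w, lo w <= hi w) ->
  let r := fmin lo / fmax hi in
  [/\ 0 <= r, r <= 1 & forall w w', r * hi w <= lo w'].
Proof.
move=> lo0 lohi r.
have min0 := fmin_ge0 lo0.
have hi0 w : 0 <= hi w := le_trans (lo0 w) (lohi w).
have max0 : 0 <= fmax hi.
  rewrite /fmax; case: pickP => // x0 _.
  exact: le_trans (hi0 x0) (le_bigmax_cond (hi x0) hi (isT : xpredT x0)).
have minmax : fmin lo <= fmax hi.
  case: (pickP T) => [w _|T0]; last first.
    by rewrite {1}/fmin; case: pickP => // w; have := T0 w.
  by apply: le_trans (fmin_le lo w) (le_trans (lohi w) (fmax_ge hi w)).
have r0 : 0 <= r by rewrite divr_ge0.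
have rmax : r * fmax hi <= fmin lo.
  rewrite /r; have [->|m0] := eqVneq (fmax hi) 0; first by rewrite mulr0.
  by rewrite divfK.
split => // [|w w'].
  rewrite /r; have [->|m0] := eqVneq (fmax hi) 0; first by rewrite invr0 mulr0.
  by rewrite ler_pdivrMr ?mul1r// lt_neqAle eq_sym m0.
apply: le_trans (fmin_le lo w'); apply: le_trans rmax.
by apply: ler_wpM2l => //; exact: fmax_ge.
Qed.

End Extrema.

(** * Set functions from additive families of positive semidefinite matrices *)

Section AdditiveMatrixFunction.
Variables (R : realType) (n : nat) (V : finType).
Variables W : {set V} -> 'M[R]_n.+1.
Hypothesis W0 : W finset.set0 = 0.
Hypothesis WU : forall S T : {set V}, [disjoint S & T] ->
  W (S :|: T) = W S + W T.
Hypothesis Wsym : forall S, (W S)^T = W S.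
Hypothesis Wpsd : forall S u, 0 <= qform (W S) u.

Let f S := lambda n.+1 (W S).

Lemma lambda_min_set0 : set_normalized f.
Proof. by rewrite /set_normalized /f W0 lambda0. Qed.

Lemma lambda_min_set_nonneg : set_nonneg f.
Proof. by move=> S; exact: lambda_min_ge0. Qed.

Let WD (Omega S : {set V}) : W (Omega :|: S) = W S + W (Omega :\: S).
Proof.
rewrite -WU; last first.
  rewrite disjoint_sym finset.disjoints_subset.
  by apply/fintype.subsetP=> x; rewrite !inE => /andP[].
by congr W; apply/finset.setP => x; rewrite !inE; case: (x \in S);
  rewrite ?orbT ?orbF.
Qed.

Let W1 j (S : {set V}) : j \notin S -> W ([set j] :|: S) = W S + W [set j].
Proof.
move=> jS; rewrite WD; congr (_ + W _).
by apply/finset.setDidPl; rewrite disjoints1.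
Qed.

Lemma lambda_min_set_monotone : set_monotone f.
Proof.
move=> S s; rewrite /f finset.setUC WD.
apply: le_trans (lambda_minD_ge (Wsym _) (Wsym _)).
by rewrite lerDl lambda_min_ge0.
Qed.

(** Subadditivity of [lambda 1], applied while the elements of [S] are split off one at a time. *)
Lemma lambda_max_sum_le (S : {set V}) :
  lambda 1 (W S) <= \sum_(w in S) lambda 1 (W [set w]).
Proof.
move Ek : #|S| => k; elim: k S Ek => [|k IH] S Sk.
  by rewrite (finset.cards0_eq Sk) W0 lambda0 finset.big_set0.
have [x xS] : exists x, x \in S by apply/card_gt0P; rewrite Sk.
have Sx : #|S :\ x| = k by move: Sk; rewrite (finset.cardsD1 x) xS => -[].
rewrite (finset.big_setD1 x)//= -{1}(finset.setD1K xS) W1 ?finset.setD11//.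
apply: le_trans (lambda_maxD_le (Wsym _) (Wsym _)) _.
  by rewrite addrC lerD2r IH.
Qed.

Lemma marginal_lambda_min_le (Omega S : {set V}) :
  marginal f Omega S <= lambda 1 (W (Omega :\: S)).
Proof. by rewrite /marginal /f WD lerBlDl lambda_minD_le. Qed.

Lemma marginal_lambda_min_ge j (S : {set V}) :
  j \notin S -> lambda n.+1 (W [set j]) <= marginal f [set j]%SET S.
Proof. by move=> jS; rewrite /marginal /f W1// lerBrDl lambda_minD_ge. Qed.

(** A marginal over [Omega] is at most the sum of [lambda 1 (W [set w])] over the new elements [w].
    Multiplication by [r] brings each summand below every [lambda n.+1 (W [set w'])], hence below
    the marginal of any single new element. *)
Lemma lambda_min_bounds :
  let r := fmin (fun w => lambda n.+1 (W [set w]%SET)) /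
           fmax (fun w => lambda 1 (W [set w]%SET)) in
  submod_admissible f r /\ curv_admissible f (1 - r).
Proof.
move=> r.
have [r0 r1 rle] := fmin_fmax_ratio
  (fun w => lambda_min_ge0 (Wsym _) (@Wpsd [set w]))
  (fun w => lambda_min_le_max (Wsym [set w])).
rewrite -/r in r0 r1 rle; split; split=> //.
- move=> Omega S; apply: le_trans (ler_wpM2l r0 (marginal_lambda_min_le _ _)) _.
  apply: le_trans (ler_wpM2l r0 (lambda_max_sum_le _)) _.
  rewrite mulr_sumr; apply: ler_sum => w; rewrite inE => /andP[wS _].
  exact: le_trans (rle w w) (marginal_lambda_min_ge wS).
- by rewrite subr_ge0.
- move=> Omega S j /finset.setDP[jS jO]; rewrite subKr.
  apply: le_trans (ler_wpM2l r0 (marginal_lambda_min_le _ _)) _.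
  (* Here the only new element is [j] itself, so the upper bound is [lambda 1 (W [set j])]. *)
  have /finset.setDidPl -> : [disjoint [set j] & S :\ j].
    by rewrite disjoints1 !inE eqxx.
  apply: le_trans (rle j j) (marginal_lambda_min_ge _).
  by rewrite !inE eqxx (negPf jO).
Qed.

End AdditiveMatrixFunction.

(** * The matrix exponential as a family of scalar power series, and its derivative *)

Section MatrixExponential.
Local Open Scope classical_set_scope.

(** There are finitely many entries, so their eventual bounds hold simultaneously. *)
Lemma cvg_mx (R : realType) m n (u : nat -> 'M[R]_(m, n)) (L : 'M[R]_(m, n)) :
  (forall i j, (fun k => u k i j) @ \oo --> L i j) -> u @ \oo --> L.
Proof.
move=> uL; apply/cvg_ballP => e e0.
suff : \forall k \near \oo, forall ij : 'I_m * 'I_n,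
    ball (L ij.1 ij.2) e (u k ij.1 ij.2).
  by apply: filterS => k H; split => // i j; exact: (H (i, j)).
apply: filter_forall => -[i j] /=.
by move/cvg_ballP: (uL i j); exact.
Qed.

Variables (R : realType) (n : nat).
Implicit Types A B : 'M[R]_n.

(** The entrywise l1 norm, used to dominate every entry of a power of [A]. *)
Definition mx_abs_sum A : R := \sum_i \sum_j `|A i j|.

Lemma norm_exprmx_le A k i j : `|(A ^+ k) i j| <= mx_abs_sum A ^+ k.
Proof.
elim: k i => [|k IH] i.
  by rewrite !expr0 mxE; case: eqP => _; rewrite ?normr1 ?normr0.
rewrite exprS mxE; apply: le_trans (ler_norm_sum _ _ _) _.
have row_le : \sum_l `|A i l| <= mx_abs_sum A.
  rewrite /mx_abs_sum [leRHS](bigD1 i)//= lerDl.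
  by apply: sumr_ge0 => *; apply: sumr_ge0.
have S0 : 0 <= mx_abs_sum A by do 2 apply: sumr_ge0 => ? _.
rewrite exprS; apply: le_trans (ler_wpM2r (exprn_ge0 _ S0) row_le).
rewrite mulr_suml; apply: ler_sum => l _.
by rewrite normrM ler_wpM2l.
Qed.

(* Coefficients of the power series in t of the (i, j) entry of A^m e^(tA). *)
Definition expmx_coef A i j m (k : nat) : R := (A ^+ (m + k)) i j / k`!%:R.

(** Differentiating the series amounts to one more factor [A]. The family indexed by [m] is thus
    closed under differentiation, and one convergence lemma serves all derivatives. *)
Lemma expmx_coef_diffs A i j m :
  pseries_diffs (expmx_coef A i j m) = expmx_coef A i j m.+1.
Proof.
apply/funext => k; rewrite /pseries_diffs /expmx_coef addSnnS factS natrM invfM.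
by rewrite mulrCA mulVKf.
Qed.

Lemma is_cvg_expmx_coef A i j m t : cvgn (pseries (expmx_coef A i j m) t).
Proof.
apply: normed_cvg => /=.
pose c := mx_abs_sum A.
have c0 : 0 <= c by do 2 apply: sumr_ge0 => ? _.
(* The majorant is the series of [c ^+ m] times the exponential of c|t|. *)
have := @is_cvg_seriesZ _ _ (c ^+ m) (is_cvg_series_exp_coeff (c * `|t|)).
apply: series_le_cvg => k //=.
  rewrite -[leRHS]/(c ^+ m * ((c * `|t|) ^+ k / k`!%:R)).
  by rewrite mulr_ge0 ?divr_ge0 ?exprn_ge0 ?mulr_ge0.
rewrite [leLHS](_ : _ = `|(A ^+ (m + k)) i j| *
    (`|t| ^+ k / k`!%:R)); last first.
  by rewrite !normrM normrX normfV normr_nat mulrAC mulrA.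
rewrite [leRHS](_ : _ = c ^+ (m + k) * (`|t| ^+ k / k`!%:R)); last first.
  by rewrite -[LHS]/(c ^+ m * ((c * `|t|) ^+ k / k`!%:R)) exprMn exprD !mulrA.
by rewrite ler_wpM2r ?divr_ge0 ?exprn_ge0// norm_exprmx_le.
Qed.

Lemma exprmxZ A t k : (t *: A) ^+ k = t ^+ k *: A ^+ k.
Proof.
elim: k => [|k IH]; first by rewrite !expr0 scale1r.
by rewrite !exprS IH -[LHS]/(_ *m _) -scalemxAl -scalemxAr scalerA.
Qed.

Lemma expmxE A t i j :
  expmx (t *: A) i j = limn (pseries (expmx_coef A i j 0) t).
Proof.
suff : series (fun k : nat => (k`!%:R)^-1 *: (t *: A) ^+ k) @ \oo -->
   \matrix_(i, j) limn (pseries (expmx_coef A i j 0) t).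
  by move=> /cvg_lim; rewrite /expmx => -> //; rewrite mxE.
apply: cvg_mx => {}i {}j; rewrite mxE.
rewrite (_ : (fun k => _) = pseries (expmx_coef A i j 0) t).
  exact: is_cvg_expmx_coef.
apply/funext => k; rewrite /pseries /series/= summxE; apply: eq_bigr => l _.
by rewrite exprmxZ !mxE /expmx_coef add0n mulrCA [LHS]mulrC [_^-1 * _]mulrC.
Qed.

Lemma trmx_exp A k : A^T ^+ k = (A ^+ k)^T.
Proof.
elim: k => [|k IH]; first by rewrite !expr0 trmx1.
by rewrite exprS IH -[LHS]/(_ *m _) -trmx_mul exprSr.
Qed.

Lemma expmx_tr A t : expmx (t *: A^T) = (expmx (t *: A))^T.
Proof.
apply/matrixP => i j; rewrite mxE !expmxE; congr (limn (pseries _ t)).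
by apply/funext => k; rewrite /expmx_coef trmx_exp mxE.
Qed.

Lemma is_derive_expmx A i j (t : R) :
  is_derive t 1 (fun t => expmx (t *: A) i j) ((A *m expmx (t *: A)) i j).
Proof.
(* Termwise differentiation at [t] needs convergence at a point of larger modulus; |t| + 1 is such a
   point. *)
have := @pseries_snd_diffs _ (expmx_coef A i j 0) (`|t| + 1) t.
rewrite !expmx_coef_diffs.
move=> /(_ (@is_cvg_expmx_coef _ _ _ _ _) (@is_cvg_expmx_coef _ _ _ _ _)
  (@is_cvg_expmx_coef _ _ _ _ _)).
rewrite [ltRHS]ger0_norm ?addr_ge0// ltrDl ltr01 => /(_ isT).
under [X in is_derive _ _ X]eq_fun do rewrite -expmxE.
suff -> : limn (pseries (expmx_coef A i j 1) t) =
  (A *m expmx (t *: A)) i j by [].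
(* Since A^(k+1) = A A^k, each partial sum of the derived series is a finite combination of partial
   sums of the entries of e^(tA). *)
rewrite mxE; under eq_bigr do rewrite expmxE.
apply/cvg_lim => //.
rewrite (_ : pseries _ t =
  (fun k => \sum_l A i l * pseries (expmx_coef A l j 0) t k)).
  apply: cvg_big => [|l _]; first by apply: add_continuous.
  by apply: cvgMl_tmp; exact: is_cvg_expmx_coef.
apply/funext => k; rewrite /pseries /series/=.
under [RHS]eq_bigr do rewrite mulr_sumr.
rewrite exchange_big/=; apply: eq_bigr => l _.
rewrite /expmx_coef add1n add0n exprS mxE !mulr_suml.
by apply: eq_bigr => p _; rewrite !mulrA.
Qed.

Lemma is_derive_mulmx_expmx A (B : 'M[R]_n) i j (t : R) :
  is_derive t 1 (fun t => (B *m expmx (t *: A)) i j)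
    ((B *m A *m expmx (t *: A)) i j).
Proof.
rewrite -mulmxA mxE.
under [X in is_derive _ _ X]eq_fun do rewrite mxE.
rewrite (_ : (fun t => _) = \sum_l (fun t => B i l * expmx (t *: A) l j)).
  apply: is_derive_sum => l.
  have := is_derive_expmx A l j t.
  exact: is_deriveZ.
by apply/funext => s; rewrite fct_sumE.
Qed.

End MatrixExponential.

(** * Exponential decay for a scalar complex linear equation with decaying forcing *)

Section Decay.
Local Open Scope classical_set_scope.
Variable R : realType.
Implicit Types f g y : R -> R.

(* [f] and [g] stand for the real and imaginary parts of a complex function. *)
Definition exp_decay f g : Prop := exists C e : R,
  0 < e /\ forall t : R, 0 <= t -> f t ^+ 2 + g t ^+ 2 <= C * expR (- e * t).

(* The system reads y' = (a + ib) y + g for y = y1 + i y2 and g = g1 + i g2.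
   Young's inequality gives (|y|^2)' <= a |y|^2 + |g|^2 / (- a), so phi below
   is nonincreasing. *)
Lemma exp_decay_ode (a b : R) y1 y2 g1 g2 : a < 0 ->
  (forall t : R, is_derive t 1 y1 (a * y1 t - b * y2 t + g1 t)) ->
  (forall t : R, is_derive t 1 y2 (b * y1 t + a * y2 t + g2 t)) ->
  exp_decay g1 g2 -> exp_decay y1 y2.
Proof.
move=> a0 dy1 dy2 [C [e [e0 gC]]].
have C0 : 0 <= C.
  have := gC 0 (lexx 0); rewrite mulr0 expR0 mulr1; apply: le_trans.
  by rewrite addr_ge0 ?sqr_ge0.
(* Half the smaller rate: [mu < e] makes [nu] positive, and [mu + a <= 0] makes the |y|^2 term left
   after Young's inequality nonpositive. *)
pose mu := Num.min e (- a) / 2.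
have mu0 : 0 < mu by rewrite divr_gt0// lt_min e0 oppr_gt0.
have minl : Num.min e (- a) <= e by rewrite ge_min lexx.
have minr : Num.min e (- a) <= - a by rewrite ge_min lexx orbT.
have mue : mu < e by rewrite /mu; lra.
have mua : mu + a <= 0 by rewrite /mu; lra.
pose nu := e - mu; have nu0 : 0 < nu by rewrite subr_gt0.
(* Chosen so that [K * nu = C / - a]: the derivative of the second term of [phi] then absorbs the
   forcing bound. *)
pose K := C / - a / nu.
have K0 : 0 <= K by rewrite !divr_ge0 ?oppr_ge0// ltW.
pose phi t := expR (mu * t) * (y1 t ^+ 2 + y2 t ^+ 2) + K * expR (- nu * t).
pose dphi t :=
  expR (mu * t) * (2 * y1 t * (a * y1 t - b * y2 t + g1 t) +
                   2 * y2 t * (b * y1 t + a * y2 t + g2 t)) +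
  mu * expR (mu * t) * (y1 t ^+ 2 + y2 t ^+ 2) - K * nu * expR (- nu * t).
have dphiE (t : R) : is_derive t 1 phi (dphi t).
  by apply: is_derive_eq; rewrite /dphi /GRing.scale/=; ring.
have dphi_le0 t : 0 <= t -> dphi t <= 0.
  move=> /gC gt; have A0 : 0 < - a by rewrite oppr_gt0.
  have young (y g : R) : 2 * y * g <= - a * y ^+ 2 + g ^+ 2 / - a.
    rewrite -subr_ge0 (_ : _ - _ = (- a * y - g) ^+ 2 / - a).
      by rewrite divr_ge0 ?sqr_ge0 ?ltW.
    by field; rewrite lt_eqF.
  have Knu : K * nu = C / - a by rewrite /K divfK ?gt_eqF.
  have Enu : expR (- nu * t) = expR (mu * t) * expR (- e * t).
    by rewrite -expRD; congr expR; rewrite /nu; ring.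
  rewrite /dphi Knu Enu; set w := y1 t ^+ 2 + y2 t ^+ 2.
  rewrite (_ : _ - _ = expR (mu * t) * ((mu + a) * w +
    (a * w + 2 * y1 t * g1 t + 2 * y2 t * g2 t) - C / - a * expR (- e * t))).
    rewrite pmulr_rle0 ?expR_gt0//.
    have H1 : (mu + a) * w <= 0 by rewrite mulr_le0_ge0// addr_ge0 ?sqr_ge0.
    have H2 := young (y1 t) (g1 t); have H3 := young (y2 t) (g2 t).
    have H4 : (g1 t ^+ 2 + g2 t ^+ 2) / - a <= C / - a * expR (- e * t).
      by rewrite mulrAC ler_pM2r ?invr_gt0.
    rewrite mulrDl in H4; rewrite /w; rewrite /w in H1; lra.
  by rewrite /w; ring.
have phi_le t : 0 <= t -> phi t <= phi 0.
  apply: (@ler0_derive1_nincry _ phi 0).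
  - by move=> x _; apply: ex_derive.
  - move=> x; rewrite in_itv/= andbT => /ltW x0.
    by rewrite derive1E derive_val dphi_le0.
  - apply: derivable_within_continuous => x _. exact: ex_derive.
  - by [].
exists (phi 0), mu; split => // t /phi_le phit.
rewrite mulNr expRN ler_pdivlMr ?expR_gt0// mulrC; apply: le_trans phit.
by rewrite lerDl mulr_ge0 ?expR_ge0.
Qed.

End Decay.

(** * Decay of e^(tA) for stable [A], and integrability of products of its entries *)

Section StableDecay.
Local Open Scope classical_set_scope.
Variables (R : realType) (n : nat) (A : 'M[R]_n.+1).
Let AC : 'M[R[i]]_n.+1 := map_mx (real_complex R) A.

(** As e^(tA) is real, the two functions are the real and imaginary parts of the (i, j) entry of B
    e^(tA). *)
Definition expmx_decay i j (B : 'M[R[i]]_n.+1) : Prop :=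
  exp_decay (fun t => (map_mx (@complex.Re R) B *m expmx (t *: A)) i j)
            (fun t => (map_mx (@complex.Im R) B *m expmx (t *: A)) i j).

(** Y = B e^(tA) solves Y' = z Y + B (A - z) e^(tA), whose forcing term decays by hypothesis; the
    two goals are the real and imaginary parts of this equation. *)
Lemma expmx_decay_step i j B z : complex.Re z < 0 ->
  expmx_decay i j (B * (AC - z%:M)) -> expmx_decay i j B.
Proof.
move=> z0; apply: (@exp_decay_ode _ _ (complex.Im z)) z0 _ _ => t.
- apply: (is_derive_eq (@is_derive_mulmx_expmx _ _ A _ i j t)).
  set BR := map_mx _ B; set BI := map_mx (@complex.Im R) B.
  have -> : map_mx (@complex.Re R) (B * (AC - z%:M)) =
      BR *m A - (complex.Re z *: BR - complex.Im z *: BI).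
    rewrite mulrBr; apply/matrixP => k l.
    rewrite -[B * AC]/(B *m AC) -[B * z%:M]/(B *m z%:M) mul_mx_scalar !mxE.
    rewrite raddfB/= raddf_sum/=; congr (_ - _); last first.
      by case: z (B k l) => [? ?] [].
    by apply: eq_bigr => m _; rewrite !mxE; case: (B k m) => p q /=;
      rewrite mulr0 subr0.
  rewrite !mulmxBl -!scalemxAl !mxE. ring.
- apply: (is_derive_eq (@is_derive_mulmx_expmx _ _ A _ i j t)).
  set BI := map_mx _ B; set BR := map_mx (@complex.Re R) B.
  have -> : map_mx (@complex.Im R) (B * (AC - z%:M)) =
      BI *m A - (complex.Im z *: BR + complex.Re z *: BI).
    rewrite mulrBr; apply/matrixP => k l.
    rewrite -[B * AC]/(B *m AC) -[B * z%:M]/(B *m z%:M) mul_mx_scalar !mxE.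
    rewrite raddfB/= raddf_sum/=; congr (_ - _); last first.
      by case: z (B k l) => [? ?] [? ?] /=; rewrite addrC.
    by apply: eq_bigr => m _; rewrite !mxE; case: (B k m) => p q /=;
      rewrite mulr0 add0r.
  rewrite !mulmxBl mulmxDl -!scalemxAl !mxE. ring.
Qed.

Lemma expmx_decay_prod i j (s : seq R[i]) B :
  (forall z, z \in s -> complex.Re z < 0) ->
  expmx_decay i j (B * \prod_(z <- s) (AC - z%:M)) -> expmx_decay i j B.
Proof.
elim: s B => [|z s IH] B s0; first by rewrite big_nil mulr1.
rewrite big_cons mulrA => /IH dB; apply: (@expmx_decay_step _ _ _ z).
  by apply: s0; rewrite mem_head.
by apply: dB => w ws; apply: s0; rewrite in_cons ws orbT.
Qed.

Lemma stable_expmx_decay i j : stable A -> exists C e : R, 0 < e /\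
  forall t, 0 <= t -> expmx (t *: A) i j ^+ 2 <= C * expR (- e * t).
Proof.
move=> stA; suff : expmx_decay i j 1.
  move=> [C [e [e0 dC]]]; exists C, e; split => // t t0.
  apply: le_trans (dC t t0).
  rewrite (_ : map_mx _ 1 = 1%:M).
    by rewrite mul1mx lerDl sqr_ge0.
  by apply/matrixP => k l; rewrite !mxE; case: eqP.
have [s Es] := closed_field_poly_normal (char_poly AC).
rewrite (monicP (char_poly_monic _)) scale1r in Es.
apply: (@expmx_decay_prod _ _ s) => [z zs|].
  apply: stA; rewrite eigenvalue_root_char -/AC Es.
  by rewrite root_prod_XsubC.
have := Cayley_Hamilton AC; rewrite Es rmorph_prod/=.
under eq_bigr do rewrite rmorphB/= horner_mx_X horner_mx_C.
(* The full product of factors is the characteristic polynomial evaluated at [AC], hence 0; the zero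
   function decays with constant 0 at any rate, here 1. *)
move=> ->; rewrite mulr0; exists 0, 1; split => // t _.
rewrite (_ : map_mx _ 0 = 0); last by apply/matrixP => k l; rewrite !mxE.
rewrite (_ : map_mx _ 0 = 0); last by apply/matrixP => k l; rewrite !mxE.
by rewrite mul0mx mxE !expr0n addr0 mul0r.
Qed.

Lemma continuous_expmx i j : continuous (fun t : R => expmx (t *: A) i j).
Proof.
move=> t; apply: differentiable_continuous; apply/derivable1_diffP.
by have := is_derive_expmx A i j t => /@ex_derive.
Qed.

Notation mu := (@lebesgue_measure R).

(** Up to the factor [e], the integrand is the density of the exponential distribution. *)
Lemma integrable_expRN (e : R) : 0 < e ->
  mu.-integrable `[0, +oo[ (fun t => (expR (- e * t))%:E).
Proof.
move=> e0.
have := integrable_exponential_pdf e0.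
move=> /(@integrableS _ _ _ mu setT `[0, +oo[ _ _ _ (@subsetT _ _)).
move=> /(_ measurableT (measurable_itv _)) ipdf.
apply: eq_integrable (integrableZl _ e^-1 ipdf) => // t.
rewrite inE/= in_itv/= andbT => t0.
by rewrite /= exponential_pdfE// -EFinM mulKf// gt_eqF.
Qed.

(** The bound |xy| <= x^2 + y^2 dominates the product by two decaying exponentials, which is why
    decay is stated for squares. *)
Lemma integrable_expmx_mul i j k l : stable A ->
  mu.-integrable `[0, +oo[
    (fun t => (expmx (t *: A) i j * expmx (t *: A) k l)%:E).
Proof.
move=> stA.
have [C [e [e0 Ce]]] := stable_expmx_decay i j stA.
have [D [d [d0 Dd]]] := stable_expmx_decay k l stA.
have int : mu.-integrable `[0, +oo[
    (fun t => (C * expR (- e * t))%:E + (D * expR (- d * t))%:E)%E.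
  apply: integrableD => //.
    by apply: (integrableZl _ C (integrable_expRN e0)).
  by apply: (integrableZl _ D (integrable_expRN d0)).
apply: le_integrable int => //.
  apply/measurable_EFinP; apply: measurable_funTS.
  apply: continuous_measurable_fun.
  by move=> t; apply: cvgM; exact: continuous_expmx.
move=> t; rewrite /= in_itv/= andbT => t0.
rewrite lee_fin.
have := Ce _ t0; have := Dd _ t0.
set x := expmx _ i j; set y := expmx _ k l => yD xC.
apply: le_trans (ler_norm _).
have x2 := sqr_ge0 (`|x| - `|y|).
have x0 := normr_ge0 x; have y0 := normr_ge0 y.
rewrite normrM; rewrite -(real_normK (num_real x)) in xC.
rewrite -(real_normK (num_real y)) in yD.
nra.
Qed.

End StableDecay.

(** * Finite sums under the integral *)

Section RintegralSum.
Local Open Scope classical_set_scope.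
Context d (T : measurableType d) (R : realType).
Variable mu : {measure set T -> \bar R}.
Variables (D : set T) (mD : measurable D).

Lemma integrable_EFin_sum I (s : seq I) (h : I -> T -> R) :
  (forall i, mu.-integrable D (fun x => (h i x)%:E)) ->
  mu.-integrable D (fun x => (\sum_(i <- s) h i x)%:E).
Proof.
move=> ih; under eq_fun do rewrite -sumEFin.
by apply: integrable_sum => // i _; exact: ih.
Qed.

Lemma Rintegral_sum I (s : seq I) (h : I -> T -> R) :
  (forall i, mu.-integrable D (fun x => (h i x)%:E)) ->
  \int[mu]_(x in D) (\sum_(i <- s) h i x) =
  \sum_(i <- s) \int[mu]_(x in D) h i x.
Proof.
move=> ih; elim: s => [|i s IH].
  under eq_Rintegral do rewrite big_nil.
  by rewrite big_nil Rintegral_cst// mul0r.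
under eq_Rintegral do rewrite big_cons.
rewrite big_cons RintegralD// ?IH//; first exact: ih.
exact: integrable_EFin_sum.
Qed.

End RintegralSum.

(** * Additivity, symmetry and positivity of the Gramian *)

Section Gramian.
Local Open Scope classical_set_scope.
Variables (R : realType) (n m : nat) (A : 'M[R]_n.+1) (b : 'I_m -> 'cV[R]_n.+1).
Hypothesis stA : stable A.
Implicit Types S T : {set 'I_m}.
Notation mu := (@lebesgue_measure R).

Definition gramian_integrand S (t : R) : 'M[R]_n.+1 :=
  expmx (t *: A) *m (\sum_(k in S) b k *m (b k)^T) *m expmx (t *: A^T).

Lemma gramianE S i j : gramian A b S i j =
  \int[mu]_(t in `[0, +oo[) gramian_integrand S t i j.
Proof. by rewrite mxE. Qed.

Lemma integrable_gramian_integrand S i j :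
  mu.-integrable `[0, +oo[ (fun t => (gramian_integrand S t i j)%:E).
Proof.
pose B : 'M[R]_n.+1 := \sum_(k in S) b k *m (b k)^T.
(* Each entry of the integrand is a finite combination of products of two entries of e^(tA). *)
rewrite [X in mu.-integrable _ X](_ : _ = (fun t =>
  (\sum_q \sum_p B p q * (expmx (t *: A) i p * expmx (t *: A) j q))%:E)).
  apply: integrable_EFin_sum => // q; apply: integrable_EFin_sum => // p.
  apply: (integrableZl _ (B p q) (integrable_expmx_mul i p j q stA)).
  by [].
apply/funext => t; congr EFin; rewrite /gramian_integrand expmx_tr mxE.
apply: eq_bigr => q _; rewrite mxE mulr_suml; apply: eq_bigr => p _.
by rewrite mxE mulrCA mulrA.
Qed.

Lemma gramian_integrand_sym S t :
  (gramian_integrand S t)^T = gramian_integrand S t.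
Proof.
rewrite /gramian_integrand expmx_tr !trmx_mul trmxK mulmxA; congr (_ *m _ *m _).
by rewrite raddf_sum/=; apply: eq_bigr => k _; rewrite trmx_mul trmxK.
Qed.

(** The form is the sum over [k] in [S] of the squares of the scalars u e^(tA) b_k. *)
Lemma gramian_integrand_psd S t u : 0 <= qform (gramian_integrand S t) u.
Proof.
rewrite /qform /gramian_integrand expmx_tr.
rewrite (_ : _ *m _ = \sum_(k in S)
    (u *m expmx (t *: A) *m b k) *m (u *m expmx (t *: A) *m b k)^T).
  rewrite summxE; apply: sumr_ge0 => k _.
  move: (u *m _ *m b k) => x.
  by rewrite mxE big_ord1 mxE -expr2 sqr_ge0.
rewrite mulmx_sumr mulmx_suml mulmx_sumr mulmx_suml; apply: eq_bigr => k _.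
by rewrite !trmx_mul !mulmxA.
Qed.

Lemma gramian_sym S : (gramian A b S)^T = gramian A b S.
Proof.
apply/matrixP => i j; rewrite mxE !gramianE; apply: eq_Rintegral => t _.
by rewrite -{1}gramian_integrand_sym mxE.
Qed.

Lemma gramian_set0 : gramian A b finset.set0 = 0.
Proof.
apply/matrixP => i j; rewrite gramianE mxE.
rewrite (@eq_Rintegral _ _ _ _ _ (cst 0)) => [|t _].
  by rewrite Rintegral_cst ?mul0r.
by rewrite /gramian_integrand finset.big_set0 mulmx0 mul0mx mxE.
Qed.

Lemma gramian_setU S T : [disjoint S & T]%B ->
  gramian A b (S :|: T)%SET = gramian A b S + gramian A b T.
Proof.
move=> ST; apply/matrixP => i j; rewrite gramianE mxE !gramianE.
rewrite -RintegralD//; do ?exact: integrable_gramian_integrand.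
apply: eq_Rintegral => t _; rewrite /gramian_integrand.
rewrite (eq_bigl [predU S & T]); last by move=> k; rewrite !inE.
by rewrite bigU//= mulmxDr mulmxDl mxE.
Qed.

(** Expanded in entries, the form is a finite sum, so it commutes with the integral and inherits the
    sign of the integrand. *)
Lemma gramian_psd S u : 0 <= qform (gramian A b S) u.
Proof.
suff -> : qform (gramian A b S) u =
    \int[mu]_(t in `[0, +oo[) qform (gramian_integrand S t) u.
  by apply: Rintegral_ge0 => t _; exact: gramian_integrand_psd.
have qformE (M : 'M[R]_n.+1) :
    qform M u = \sum_j \sum_i (u 0 i * u 0 j) * M i j.
  rewrite /qform mxE; apply: eq_bigr => j _; rewrite mxE mulr_suml.
  by apply: eq_bigr => i _; rewrite mxE mulrAC.
have intZ i j : mu.-integrable `[0, +oo[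
    (fun t => (u 0 i * u 0 j * gramian_integrand S t i j)%:E).
  exact: (integrableZl _ _ (integrable_gramian_integrand S i j)).
rewrite qformE; under eq_Rintegral do rewrite qformE.
rewrite Rintegral_sum// => [|j]; last exact: integrable_EFin_sum.
apply: eq_bigr => j _; rewrite Rintegral_sum//; apply: eq_bigr => i _.
by rewrite RintegralZl// ?gramianE//; exact: integrable_gramian_integrand.
Qed.

End Gramian.

Theorem proposition1 (R : realType) (n M : nat) (A : 'M[R]_n)
    (b : 'I_M -> 'cV[R]_n) :
  stable A -> injective b -> (exists i : 'I_M, b i != 0) ->
  let W : {set 'I_M} -> 'M[R]_n := gramian A b in
  let f : {set 'I_M} -> R := fun S => lambda n (W S) in
  let r : R := fmin (fun w : 'I_M => lambda n (W [set w]%SET)) /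
               fmax (fun w : 'I_M => lambda 1 (W [set w]%SET)) in
  [/\ set_nonneg f, set_monotone f, set_normalized f,
      (r%:E <= submodularity_ratio f)%E
    & (curvature f <= (1 - r)%:E)%E].
Proof.
move=> stA _ [i bi] W f r.
(* A nonzero column excludes dimension 0, where the least eigenvalue has no eigenvector. *)
case: n => [|n] in A b stA bi W f r *.
  by case/eqP: bi; apply/colP => -[].
have W0 : W finset.set0 = 0 by exact: gramian_set0.
have WU := gramian_setU b stA.
have Wsym := gramian_sym A b.
have Wpsd := gramian_psd b stA.
have [fr fa] := lambda_min_bounds W0 WU Wsym Wpsd.
split.
- exact: lambda_min_set_nonneg.
- exact: lambda_min_set_monotone.
- exact: lambda_min_set0.
- by apply: ereal_sup_ubound; exists r.
- by apply: ereal_inf_lbound; exists (1 - r).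
Qed.
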